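(* Let $V=\coprod_{n\in\mathbb{N}}V_{(n)}$ be an $\mathbb{N}$-graded vertex algebra over $\mathbb{C}$ with $V_{(0)}=\mathbb{C}\mathbf{1}$. For a graded subspace $U$ of $V_+=\coprod_{n>0}V_{(n)}$ which strongly generates $V$, let $E_n^U$ ($n\ge0$) be the subspace of $V$ linearly spanned by the vectors $$u^{(1)}_{-k_1}\cdots u^{(r)}_{-k_r}\mathbf{1}$$ with $r\ge0$, $u^{(i)}\in U$ homogeneous, $k_i\ge1$ and $\mathrm{wt}\,u^{(1)}+\cdots+\mathrm{wt}\,u^{(r)}\le n$, and let $E_n^U=0$ for $n<0$. Then the (good) filtration $E_U=\{E_n^U\}$ does not depend on the choice of the graded strong generating subspace $U$. Furthermore, this filtration is the unique finest good filtration $\{E_n\}$ of $V$ with the property that $V_{(n)}\subset E_n$ for all $n\ge0$.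
   Context: Vertex algebra: a vector space $V$ over $\mathbb{C}$ with a linear map $Y:V\to\mathrm{Hom}(V,V((x)))$, $v\mapsto Y(v,x)=\sum_{n\in\mathbb{Z}}v_nx^{-n-1}$ ($v_n\in\mathrm{End}\,V$), and a vector $\mathbf{1}\in V$ such that $Y(\mathbf{1},x)=\mathrm{id}$; $Y(v,x)\mathbf{1}\in V[[x]]$ with $v_{-1}\mathbf{1}=v$ for $v\in V$; and for $u,v\in V$ the Jacobi identity holds: $$x_0^{-1}\delta\left(\tfrac{x_1-x_2}{x_0}\right)Y(u,x_1)Y(v,x_2)-x_0^{-1}\delta\left(\tfrac{x_2-x_1}{-x_0}\right)Y(v,x_2)Y(u,x_1)=x_2^{-1}\delta\left(\tfrac{x_1-x_0}{x_2}\right)Y(Y(u,x_0)v,x_2),$$ where $\delta(x)=\sum_{n\in\mathbb{Z}}x^n$ and powers of binomials are expanded in nonnegative powers of the second variable. $\mathbb{N}=\{0,1,2,\dots\}$. An $\mathbb{N}$-graded vertex algebra is a vertex algebra with a grading $V=\coprod_{n\in\mathbb{N}}V_{(n)}$ such that $u_mV_{(n)}\subset V_{(n+k-m-1)}$ for $u\in V_{(k)}$, $m\in\mathbb{Z}$ (with $V_{(j)}=0$ for $j<0$). For $v\in V_{(n)}$, $v$ is homogeneous of weight $\mathrm{wt}\,v=n$. A subspace $U$ is graded if $U=\coprod_n(U\cap V_{(n)})$. A subspace $U$ strongly generates $V$ if $V=\mathrm{span}\{u^{(1)}_{-n_1}\cdots u^{(r)}_{-n_r}\mathbf{1}\mid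 r\ge0,\ u^{(i)}\in U,\ n_i\ge1\}$. Good filtration of $V$: an increasing family of subspaces $\cdots\subset E_{-1}\subset E_0\subset E_1\subset\cdots$ ($n\in\mathbb{Z}$) with $\bigcup_{n\in\mathbb{Z}}E_n=V$, $\mathbf{1}\in E_0$, and for $u\in E_m$, $v\in E_n$: $u_jv\in E_{m+n}$ for $j<0$ and $u_jv\in E_{m+n-1}$ for $j\ge0$. A filtration $\{E_n\}$ is finer than $\{E_n'\}$ if $E_n\subset E_n'$ for all $n\in\mathbb{Z}$; the finest filtration with a property is the one that is finer than every good filtration with that property. *)

(* Defs.v *)
From HB Require Import structures.
From mathcomp Require Export all_boot all_order all_algebra.
From mathcomp Require Export boolp classical_sets fsbigop reals.
From mathcomp Require Export complex.

Set Implicit Arguments.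
Unset Strict Implicit.
Unset Printing Implicit Defensive.

Import GRing.Theory.
Local Open Scope classical_set_scope.
Local Open Scope ring_scope.

Section FormalCalculus.
Variable K : fieldType.

(* A formal distribution in three variables with coefficients in [W] is
   represented by its coefficient function:
   [F a b c] is the coefficient of x0^a x1^b x2^c. *)
Definition fdist3 (W : Type) := int -> int -> int -> W.

Definition zbinom (n : int) (i : nat) : K :=
  (\prod_(j < i) (n - (j : nat)%:Z)%:~R) / i`!%:R.

(* The coefficient of y^b z^c in (y - z)^n, expanded in nonnegative powers
   of z. *)
Definition subpow_coef (n b c : int) : K :=
  if c is Posz i then (if b == n - i%:Z then (-1) ^+ i * zbinom n i else 0)
  else 0.

(* The coefficient of x^a y^b z^c in
     x^-1 delta((y - z) / (e x)) = sum_n e^-n x^(-n-1) (y - z)^n. *)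
Definition delta_coef (e : K) (a b c : int) : K :=
  let n := - a - 1 in e ^ (- n) * subpow_coef n b c.

(* Product of a scalar and of a vector-valued distribution.  The sum is over
   the finite support of the summand; in the Jacobi identity below this support
   is always finite, by the lower truncation of [Y]. *)
Definition fdist_mul (V : lmodType K) (D : fdist3 K) (F : fdist3 V) :
    fdist3 V :=
  fun a b c => \sum_(k \in [set: int * int * int])
    D k.1.1 k.1.2 k.2 *: F (a - k.1.1) (b - k.1.2) (c - k.2).

End FormalCalculus.

Section VertexAlgebra.
Variables (K : fieldType) (V : lmodType K).

(* A vertex operator map is given by its modes: [Y v n w] is v_n w, that is,
   the coefficient of x^(-n-1) in Y(v,x)w. *)
Implicit Types (Y : V -> int -> V -> V) (one : V).

(* Y(u,x1)Y(v,x2)w, Y(v,x2)Y(u,x1)w and Y(Y(u,x0)v,x2)w *)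
Definition YuYv Y (u v w : V) : fdist3 V := fun a b c =>
  if a == 0 then Y u (- b - 1) (Y v (- c - 1) w) else 0.
Definition YvYu Y (u v w : V) : fdist3 V := fun a b c =>
  if a == 0 then Y v (- c - 1) (Y u (- b - 1) w) else 0.
Definition YYuv Y (u v w : V) : fdist3 V := fun a b c =>
  if b == 0 then Y (Y u (- a - 1) v) (- c - 1) w else 0.

Definition jacobi_identity Y := forall (u v w : V) (a b c : int),
  fdist_mul (fun i j k => delta_coef 1 i j k) (YuYv Y u v w) a b c
  - fdist_mul (fun i j k => delta_coef (-1) i k j) (YvYu Y u v w) a b c
  = fdist_mul (fun i j k => delta_coef 1 k j i) (YYuv Y u v w) a b c.

Record vertex_algebra Y one : Prop := VertexAlgebra {
  va_linear_l : forall n w, linear (fun v => Y v n w);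
  va_linear_r : forall v n, linear (Y v n);
  va_truncation : forall v w, exists N : int, forall n, N <= n -> Y v n w = 0;
  va_vacuum : forall n w, Y one n w = if n == -1 then w else 0;
  va_creation : forall v n, 0 <= n -> Y v n one = 0;
  va_creation_m1 : forall v, Y v (-1) one = v;
  va_jacobi : jacobi_identity Y
}.

Definition subspace (A : set V) : Prop :=
  A 0 /\ forall (a : K) (u v : V), A u -> A v -> A (a *: u + v).

Definition lspan (A : set V) : set V := smallest subspace A.

Definition sumset (G : nat -> set V) : set V :=
  [set v | exists (N : nat) (f : nat -> V),
     (forall n, G n (f n)) /\ v = \sum_(n < N) f n].

Definition is_coprod (A : set V) (G : nat -> set V) : Prop :=
  [/\ forall n, subspace (G n), A = sumset G &
      forall (N : nat) (f : nat -> V), (forall n, G n (f n)) ->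
        \sum_(n < N) f n = 0 -> forall n, (n < N)%N -> f n = 0].

Definition int_grading (G : nat -> set V) (j : int) : set V :=
  if j is Posz n then G n else [set 0].

Record graded_vertex_algebra Y one (G : nat -> set V) : Prop :=
  GradedVertexAlgebra {
  gva_va : vertex_algebra Y one;
  gva_coprod : is_coprod setT G;
  gva_mode : forall (k n : nat) (m : int) (u v : V), G k u -> G n v ->
    int_grading G (n%:Z + k%:Z - m - 1) (Y u m v)
}.

Definition graded_subspace (G : nat -> set V) (U : set V) : Prop :=
  subspace U /\ is_coprod U (fun n => U `&` G n).

Definition positive_part (G : nat -> set V) : set V :=
  sumset (fun n => G n.+1).

(* [:: (u1, k1); ...; (ur, kr)] is sent to (u1)_{-k1} ... (ur)_{-kr} 1 *)
Definition monomial Y one (s : seq (V * nat)) : V :=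
  foldr (fun p w => Y p.1 (- p.2%:Z) w) one s.

Definition strongly_generates Y one (U : set V) : Prop :=
  setT = lspan [set v | exists2 s : seq (V * nat),
    (forall u k, (u, k) \in s -> U u /\ (1 <= k)%N) & v = monomial Y one s].

(* An item (u, k, d) of [t] stands for the factor u_{-k} with wt u = d. *)
Definition EU Y one (G : nat -> set V) (U : set V) (n : int) : set V :=
  if n is Posz m then
    lspan [set v | exists t : seq (V * nat * nat),
      [/\ forall u k d, (u, k, d) \in t -> [/\ U u, G d u & (1 <= k)%N],
          (\sum_(p <- t) p.2 <= m)%N &
          v = monomial Y one [seq p.1 | p <- t]]]
  else [set 0].

Record good_filtration Y one (E : int -> set V) : Prop := GoodFiltration {
  gf_subspace : forall n, subspace (E n);
  gf_incr : forall n, E n `<=` E (n + 1);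
  gf_cover : \bigcup_(n in [set: int]) E n = setT;
  gf_one : E 0 one;
  gf_neg : forall (m n j : int) u v,
    E m u -> E n v -> j < 0 -> E (m + n) (Y u j v);
  gf_nonneg : forall (m n j : int) u v,
    E m u -> E n v -> 0 <= j -> E (m + n - 1) (Y u j v)
}.

Definition finer (E E' : int -> set V) : Prop := forall n, E n `<=` E' n.

Definition finest_good_filtration Y one (P : (int -> set V) -> Prop)
    (E : int -> set V) : Prop :=
  [/\ good_filtration Y one E, P E &
      forall E', good_filtration Y one E' -> P E' -> finer E E'].

End VertexAlgebra.

(* Main.v *)
(** The filtration E_U is the smallest candidate: in any good filtration F with
    V_(n) in F_n, a monomial u^(1)_{-k_1} ... u^(r)_{-k_r} 1 lies in F_m, m the
    sum of the weights of the u^(i).  So it suffices to show that E_U is good and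
    contains V_(n) in its n-th term: being the finest such filtration, it then
    cannot depend on U.  The key point is that b_l E_n lies in E_{n + wt b}, and
    even in E_{n + wt b - 1} when l >= 0, for every homogeneous b in V, not only
    for b in U.  This follows by induction on wt b + n from Borcherds' commutator
    formula and the iterate formula for (u_{-k} b')_l, two residues of the Jacobi
    identity; only the shape of these formulas matters, not their coefficients.
    Applied to v = v_{-1} 1 this gives V_(n) in E_n, and the iterate formula once
    more passes from homogeneous b to all of E_m. *)

Require Import Defs.
From mathcomp Require Import zify.
Import GRing.Theory.

Local Open Scope classical_set_scope.
Local Open Scope ring_scope.

(** * Subspaces, linear spans and direct sum decompositions *)

Section Subspaces.
Set Implicit Arguments.
Unset Strict Implicit.
Variables (K : fieldType) (V : lmodType K).
Implicit Types (P A : set V) (G : nat -> set V).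

Lemma subspaceD P u v : subspace P -> P u -> P v -> P (u + v).
Proof. by case=> _ hP Pu Pv; rewrite -[u]scale1r; exact: hP. Qed.

Lemma subspaceZ P a u : subspace P -> P u -> P (a *: u).
Proof. by case=> P0 hP Pu; rewrite -[_ *: _]addr0; exact: hP. Qed.

Lemma subspaceB P u v : subspace P -> P u -> P v -> P (u - v).
Proof.
move=> hP Pu Pv; rewrite -scaleN1r; apply: subspaceD => //.
exact: subspaceZ.
Qed.

Lemma subspace_sum P (I : Type) (r : seq I) (C : pred I) (F : I -> V) :
  subspace P -> (forall i, C i -> P (F i)) -> P (\sum_(i <- r | C i) F i).
Proof.
move=> hP PF; elim/big_ind : _ => // [|u v]; first by case: hP.
exact: subspaceD.
Qed.

Lemma subspace_fsum P (I : choiceType) (F : I -> V) :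
  subspace P -> (forall i, P (F i)) -> P (\sum_(i \in [set: I]) F i).
Proof. by move=> hP PF; exact: subspace_sum. Qed.

Lemma fsum_single (I : choiceType) (i0 : I) (F : I -> V) :
  (forall i, i <> i0 -> F i = 0) -> \sum_(i \in [set: I]) F i = F i0.
Proof.
move=> F0; rewrite -[RHS](@fsbig_set1 _ 0 +%R _ i0 F).
apply/esym/fsbig_widen => //.
by move=> i [_ /F0].
Qed.

Lemma subspace0 : subspace [set (0 : V)].
Proof. by split=> // a u v -> ->; rewrite scaler0 addr0. Qed.

Lemma linear0 (f : V -> V) : linear f -> f 0 = 0.
Proof. by move=> fl; have := fl (-1) 0 0; rewrite !scaleN1r !addNr. Qed.

Lemma linear_sumE (f : V -> V) N (F : nat -> V) : linear f ->
  f (\sum_(i < N) F i) = \sum_(i < N) f (F i).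
Proof.
move=> fl; elim: N => [|N IH]; first by rewrite !big_ord0 linear0.
by rewrite !big_ord_recr /= addrC -[F N]scale1r fl IH !scale1r addrC.
Qed.

Lemma subspace_preim P (f : V -> V) :
  linear f -> subspace P -> subspace (f @^-1` P).
Proof.
move=> fl [P0 hP]; split=> [|a u v Pu Pv] /=; first by rewrite linear0.
by rewrite fl; exact: hP.
Qed.

Lemma lspan_subspace A : subspace (lspan A).
Proof.
split=> [P [[P0 _] _] //|a u v Au Av P hP].
by case: (hP) => -[_ h] _; apply: h; [exact: Au | exact: Av].
Qed.

Lemma lspan_gen A : A `<=` lspan A.
Proof. by move=> u Au P [_]; exact. Qed.

Lemma lspan_min A P : subspace P -> A `<=` P -> lspan A `<=` P.
Proof. by move=> hP AP u; apply. Qed.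

(** Padding with zeros lets two decompositions share a common length. *)
Lemma sumset_pad G v : (forall n, subspace (G n)) -> sumset G v ->
  exists N, forall M, (N <= M)%N ->
    exists2 f : nat -> V, forall n, G n (f n) & v = \sum_(n < M) f n.
Proof.
move=> hG [N [f [fG ->]]]; exists N => M NM.
exists (fun n => if (n < N)%N then f n else 0).
  by move=> n; case: ifP => // _; case: (hG n).
by rewrite (big_ord_widen _ f NM) big_mkcond.
Qed.

Lemma sumset_subspace G : (forall n, subspace (G n)) -> subspace (sumset G).
Proof.
move=> hG; split=> [|a u v /(sumset_pad hG)[N1 h1] /(sumset_pad hG)[N2 h2]].
  by exists 0%N, (fun=> 0); rewrite big_ord0; split=> // n; case: (hG n).
have [f fG ->] := h1 _ (leq_maxl N1 N2); have [g gG ->] := h2 _ (leq_maxr N1 N2).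
exists (maxn N1 N2), (fun n => a *: f n + g n); split=> [n|].
  by case: (hG n) => _; apply.
by rewrite scaler_sumr big_split.
Qed.

Lemma sumset_in G n : (forall n, subspace (G n)) -> G n `<=` sumset G.
Proof.
move=> hG v Gv; exists n.+1, (fun i => if i == n then v else 0); split.
  by move=> i; case: eqP => [->|_] //; case: (hG i).
rewrite big_ord_recr /= eqxx big1 ?add0r // => i _.
by rewrite ltn_eqF.
Qed.

(** Decompose [v] along the [S n]. Subtracting [v] from the component of index [p] leaves a zero sum
    of homogeneous vectors, so by directness that component is [v]. *)
Lemma coprod_sub_eq G S : is_coprod setT G -> (forall n, subspace (S n)) ->
  (forall n, S n `<=` G n) -> setT `<=` sumset S -> forall n, G n `<=` S n.
Proof.
move=> [hG _ Gd] hS SG ST p v Gv.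
have [N hN] := sumset_pad hS (ST v I).
have [f fS vE] := hN _ (leq_maxl N p.+1).
pose g n := f n - (if n == p then v else 0).
have gG n : G n (g n).
  apply: subspaceB => //; first exact/SG.
  by case: eqP => [->|_] //; case: (hG n).
have pM : (p < maxn N p.+1)%N by exact: leq_maxr.
have g0 : \sum_(n < maxn N p.+1) g n = 0.
  rewrite big_split /= -vE sumrN (bigD1 (Ordinal pM)) //= eqxx.
  rewrite big1 ?addr0 ?subrr //.
  by move=> i; rewrite -val_eqE /= => /negPf ->.
have := Gd _ g gG g0 p pM; rewrite /g eqxx => /eqP.
by rewrite subr_eq0 => /eqP <-.
Qed.

End Subspaces.

(** * Two residues of the Jacobi identity *)

Section Borcherds.
Set Implicit Arguments.
Unset Strict Implicit.
Variables (K : fieldType).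

Lemma delta_coef_supp (e : K) a b c : delta_coef e a b c = 0 \/
  exists2 s : nat, c = s%:Z & b = - a - 1 - s%:Z.
Proof.
rewrite /delta_coef /subpow_coef; case: c => [s|s]; last by left; rewrite mulr0.
by case: eqP => [->|_]; [right; exists s | left; rewrite mulr0].
Qed.

Lemma zbinom_small (s i : nat) : (s < i)%N -> zbinom K s%:Z i = 0.
Proof.
move=> si; rewrite /zbinom (bigD1 (Ordinal si)) //= subrr mul0r.
by rewrite mul0r.
Qed.

Lemma delta_coef_pole (e : K) b c :
  delta_coef e (-1) b c = ((b == 0) && (c == 0))%:R.
Proof.
rewrite /delta_coef opprK subrr oppr0 expr0z mul1r /subpow_coef.
case: c => [[|s]|s]; rewrite ?andbF //=.
  rewrite subr0 andbT /zbinom big_ord0 fact0 divr1 mulr1.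
  by case: eqP.
by rewrite (zbinom_small (ltn0Sn s)) mulr0 if_same.
Qed.

(** For [c = s + 1] the binomial has exponent [s], and $(y-z)^s$ contains no negative power of
    $y$. *)
Lemma delta_coef_middle (a c : int) :
  delta_coef (1 : K) a (-1) c = ((a == 0) && (c == 0))%:R.
Proof.
rewrite /delta_coef exp1rz mul1r /subpow_coef.
case: c => [[|s]|s]; rewrite ?andbF //=.
  rewrite subr0 andbT /zbinom big_ord0 fact0 divr1 mulr1.
  have -> : (-1 == - a - 1) = (a == 0) by apply/eqP/eqP => [h|->]; lia.
  by case: eqP.
case: eqP => // h; have -> : - a - 1 = s%:Z by lia.
by rewrite zbinom_small // mulr0.
Qed.

Variables (V : lmodType K) (Y : V -> int -> V -> V) (one : V).
Hypothesis hY : vertex_algebra Y one.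

(* The Jacobi identity at x0^-1: Borcherds' commutator formula, with the values
   of its binomial coefficients left out. *)
Lemma commutator_in (P : set V) u v w (l m : int) : subspace P ->
  (forall s : nat, P (Y (Y u s%:Z v) (l + m - s%:Z) w)) ->
  P (Y u l (Y v m w) - Y v m (Y u l w)).
Proof.
move=> hP h.
have := va_jacobi hY u v w (-1) (- l - 1) (- m - 1).
(* The products involve only $x_0^0$, so [i = -1], where the delta coefficient is that of $(y-z)^0 =
   1$: each sum on the left has one term. *)
rewrite /fdist_mul (@fsum_single _ _ _ (-1, 0, 0)) => [|[[i j] k] ne]; last first.
  rewrite /= /YuYv; case: eqP => [ai|_]; last by rewrite scaler0.
  have -> : i = -1 by lia.
  by rewrite delta_coef_pole;
    case: andP ne => [[/eqP-> /eqP->] []|_ _]; rewrite ?scale0r //;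
    congr (_, _, _); lia.
rewrite (@fsum_single _ _ _ (-1, 0, 0)) => [|[[i j] k] ne]; last first.
  rewrite /= /YvYu; case: eqP => [ai|_]; last by rewrite scaler0.
  have -> : i = -1 by lia.
  by rewrite delta_coef_pole;
    case: andP ne => [[/eqP-> /eqP->] []|_ _]; rewrite ?scale0r //;
    congr (_, _, _); lia.
rewrite /= !delta_coef_pole /= !scale1r /YuYv /YvYu subrr eqxx !subr0.
have modeK x : - (- x - 1) - 1 = x :> int by lia.
rewrite !modeK => ->.
apply: (subspace_fsum hP) => -[[i j] k] /=.
have [->|[s -> E]] := delta_coef_supp 1 k j i.
  by rewrite scale0r; case: hP.
apply: (subspaceZ _ hP); rewrite /YYuv; case: eqP => [bj|_]; last by case: hP.
have -> : - (-1 - s%:Z) - 1 = s%:Z by lia.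
have -> : - (- m - 1 - k) - 1 = l + m - s%:Z by lia.
exact: h.
Qed.

(* The Jacobi identity at x1^-1: the expansion of Y(u_n v, x2), again without
   the values of the binomial coefficients. *)
Lemma iterate_in (P : set V) u v w (n m : int) : subspace P ->
  (forall s : nat, P (Y u (n - s%:Z) (Y v (m + s%:Z) w))) ->
  (forall s : nat, P (Y v (m + n - s%:Z) (Y u s%:Z w))) ->
  P (Y (Y u n v) m w).
Proof.
move=> hP h1 h2.
have := va_jacobi hY u v w (- n - 1) (- 1) (- m - 1).
rewrite /fdist_mul [X in _ = X](@fsum_single _ _ _ (0, -1, 0)) =>
  [|[[i j] k] ne]; last first.
  rewrite /= /YYuv; case: eqP => [bj|_]; last by rewrite scaler0.
  have -> : j = -1 by lia.
  by rewrite delta_coef_middle;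
    case: andP ne => [[/eqP-> /eqP->] []|_ _]; rewrite ?scale0r //;
    congr (_, _, _); lia.
rewrite /= delta_coef_middle /= scale1r /YYuv subrr eqxx !subr0.
have modeK x : - (- x - 1) - 1 = x :> int by lia.
rewrite !modeK => <-.
apply: (subspaceB hP); apply: (subspace_fsum hP) => -[[i j] k] /=.
  have [->|[s -> E]] := delta_coef_supp 1 i j k.
    by rewrite scale0r; case: hP.
  apply: (subspaceZ _ hP); rewrite /YuYv; case: eqP => [ai|_]; last by case: hP.
  have -> : - (-1 - j) - 1 = n - s%:Z by lia.
  have -> : - (- m - 1 - s%:Z) - 1 = m + s%:Z by lia.
  exact: h1.
have [->|[s -> E]] := delta_coef_supp (-1) i k j.
  by rewrite scale0r; case: hP.
apply: (subspaceZ _ hP); rewrite /YvYu; case: eqP => [ai|_]; last by case: hP.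
have -> : - (-1 - s%:Z) - 1 = s%:Z by lia.
have -> : - (- m - 1 - k) - 1 = m + n - s%:Z by lia.
exact: h2.
Qed.
End Borcherds.

(** * The filtration attached to a strong generating subspace *)

Section StrongGenerators.
Set Implicit Arguments.
Unset Strict Implicit.
Variables (K : fieldType) (V : lmodType K) (Y : V -> int -> V -> V) (one : V).
Variables (G : nat -> set V) (U : set V).
Hypothesis hV : graded_vertex_algebra Y one G.
Hypothesis G0one : G 0%N one.
Hypothesis gradedU : graded_subspace G U.
Hypothesis posU : U `<=` positive_part G.
Hypothesis genU : strongly_generates Y one U.

Local Notation E := (EU Y one G U).
Arguments EU : simpl never.

Let hY : vertex_algebra Y one := gva_va hV.
Let linl n w : linear (fun v => Y v n w) := va_linear_l hY n w.
Let linr v n : linear (Y v n) := va_linear_r hY v n.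

Lemma mode0l n w : Y 0 n w = 0.
Proof. exact: linear0 (linl n w). Qed.

Lemma mode0r v n : Y v n 0 = 0.
Proof. exact: linear0 (linr v n). Qed.

Lemma G_subspace n : subspace (G n).
Proof. by case: (gva_coprod hV). Qed.

(** Directness separates degree 0 from the positive degrees. Discarding factors of weight 0 makes
    weights drop strictly in the inductions below. *)
Lemma U_weight0 u : U u -> G 0%N u -> u = 0.
Proof.
move=> /posU[N [f [fG uE]]] Gu; have [_ _ Gd] := gva_coprod hV.
pose g n := if n is n'.+1 then f n' else - u.
have gG n : G n (g n).
  by case: n => [|n] //=; rewrite -scaleN1r; exact: subspaceZ (G_subspace 0) Gu.
have g0 : \sum_(n < N.+1) g n = 0 by rewrite big_ord_recl /= -uE addNr.
by have /oppr_inj := etrans (Gd _ g gG g0 0%N isT) (esym (oppr0 V)).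
Qed.

Lemma EU_subspace n : subspace (E n).
Proof. by case: n => n; [exact: lspan_subspace | exact: subspace0]. Qed.

Lemma EU_neg (n : int) v : n < 0 -> E n v -> v = 0.
Proof. by case: n. Qed.

Lemma EU_le (m n : int) : m <= n -> E m `<=` E n.
Proof.
case: m n => [m|m] [n|n] // mn; last 2 first.
- by move=> v ->; case: (EU_subspace n).
- by [].
apply: lspan_min => [|_ [t [ht tm ->]]]; first exact: lspan_subspace.
by apply: lspan_gen; exists t; split=> //; apply: leq_trans tm _.
Qed.

Lemma EU_one n : 0 <= n -> E n one.
Proof.
by case: n => // n _; apply: lspan_gen; exists [::]; rewrite big_nil.
Qed.

Lemma EU_mul (d k : nat) (n : int) u w :
  U u -> G d u -> (0 < k)%N -> E n w -> E (d%:Z + n) (Y u (- k%:Z) w).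
Proof.
move=> Uu Gu k0; case: n => [n|n] Ew; last first.
  by rewrite (EU_neg _ Ew) // mode0r; case: (EU_subspace (d%:Z + Negz n)).
have hP := subspace_preim (linr u (- k%:Z)) (EU_subspace (d%:Z + n%:Z)).
apply: (lspan_min hP) Ew => _ [t [ht tm ->]] /=.
apply: lspan_gen; exists ((u, k, d) :: t); split => //.
  by move=> u' k' d'; rewrite inE => /orP[/eqP[-> -> ->]|/ht].
by rewrite big_cons leq_add2l.
Qed.

(** Induction on the length of a monomial, which also keeps the tail in [E n]. A factor of weight 0
    vanishes, whence the premise [0 < d]. *)
Lemma EU_ind (P : nat -> set V) : (forall n, subspace (P n)) ->
  (forall n, P n one) ->
  (forall (d k n : nat) u w, U u -> G d u -> (0 < d)%N -> (0 < k)%N ->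
     E n w -> P n w -> P (d + n)%N (Y u (- k%:Z) w)) ->
  forall n : nat, E n `<=` P n.
Proof.
move=> hP P1 PM n; apply: lspan_min => // _ [t [ht tn ->]].
suff [] : E n (monomial Y one [seq p.1 | p <- t]) /\
          P n (monomial Y one [seq p.1 | p <- t]) by [].
elim: t n ht tn => [|[[u k] d] t IH] n ht /=.
  by move=> _; split=> //; exact: (EU_one (n := n)).
rewrite big_cons /= => dn; have dn' : (d <= n)%N by lia.
have [Uu Gu k0] := ht u k d (mem_head _ _).
have [u' k' d' tin||Et Pt] := IH (n - d)%N; [|lia|].
  by apply: ht; rewrite inE tin orbT.
have [d0|d0] := posnP d.
  rewrite d0 in Gu; rewrite (U_weight0 Uu Gu) mode0l.
  by split; [case: (EU_subspace n)|case: (hP n)].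
rewrite -(subnKC dn'); split; last exact: PM.
by rewrite PoszD; exact: EU_mul.
Qed.

(* The tail [w] is an arbitrary homogeneous vector rather than a monomial: this
   is enough for the induction on weights. *)
Definition weight_monomials (p : nat) : set V :=
  [set v | p = 0%N /\ v = one \/
    exists d k q u w, [/\ U u, G d u, G q w, (0 < k)%N &
      (d + k + q = p.+1)%N] /\ v = Y u (- k%:Z) w].

(** These spans lie in the matching degrees and together exhaust [V] by strong generation, so
    [coprod_sub_eq] applies. *)
Lemma weight_spanned p : G p `<=` lspan (weight_monomials p).
Proof.
pose S n := lspan (weight_monomials n).
have hS n : subspace (S n) by exact: lspan_subspace.
have Slift n := sumset_in hS (n := n).
move: p; apply: (coprod_sub_eq (gva_coprod hV) hS) => [n|].
  apply: lspan_min => [|v]; first exact: G_subspace.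
  case=> [[-> ->] //|].
  move=> [d [k [q [u [w [[Uu Gu Gw k0 dkq] ->]]]]]].
  have := gva_mode hV (- k%:Z) Gu Gw.
  by have -> : q%:Z + d%:Z - - k%:Z - 1 = n%:Z by lia.
rewrite genU; apply: lspan_min => [|_ [[|[u k] s] hs ->] /=].
- exact: sumset_subspace.
- by apply: (Slift 0%N); apply: lspan_gen; left.
have [Uu k0] := hs u k (mem_head _ _).
move: (monomial _ _ _) => w {s hs}.
have [hG VG _] := gva_coprod hV.
have: sumset G w by rewrite -VG.
have [_ [hUG UE _]] := gradedU.
move: Uu; rewrite UE => -[N [f [fU ->]]] [M [g [gG ->]]].
have hT := sumset_subspace hS.
rewrite (linear_sumE _ _ (linr _ _)); apply: subspace_sum => // j _.
rewrite (linear_sumE _ _ (linl _ _)); apply: subspace_sum => // i _.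
have [Uf Gf] := fU i; have Gg := gG j.
(* The weight of $(f_i)_{-k} g_j$; the predecessor is exact since [k] is positive. *)
apply: (Slift (i + k + j).-1); apply: lspan_gen; right.
exists (val i), k, (val j), (f i), (g j); split=> //; split=> //.
by rewrite prednK // addn_gt0 addn_gt0 k0 orbT.
Qed.

(* Induction on the total weight [p + n].  A nonnegative mode of [b] is commuted
   past the first factor [a] of a monomial; the correction terms involve [b_s a]
   with [s >= 0], of weight less than [wt a + wt b].  A negative mode is reduced
   to smaller weights by writing [b] through [u_{-k} b'], [u] in [U]. *)
Lemma G_mode_EU N : forall p n : nat, (p + n <= N)%N ->
  forall b w (l : int), G p b -> E n w ->
    E (p + n)%N (Y b l w) /\ (0 <= l -> E ((p + n)%:Z - 1) (Y b l w)).
Proof.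
elim/ltn_ind: N => N IH.
have nonneg p n b w (l : int) : (p + n <= N)%N -> G p b -> E n w -> 0 <= l ->
    E ((p + n)%:Z - 1) (Y b l w).
  move=> pnN Gb Ew l0; move: pnN.
  (* The bound sits inside [P] because [n] varies along the monomial. *)
  pose P n := [set w | (p + n <= N)%N -> E ((p + n)%:Z - 1) (Y b l w)].
  apply: (EU_ind (P := P)) Ew => {n w} [n|n _|d k n a w Ua Ga d0 k0 Ew _].
  - split=> [_|c u v Pu Pv le] /=.
      by rewrite mode0r; case: (EU_subspace ((p + n)%:Z - 1)).
    rewrite linr; have [_ h] := EU_subspace ((p + n)%:Z - 1).
    by apply: h; [exact: Pu | exact: Pv].
  - by rewrite va_creation //; case: (EU_subspace ((p + n)%:Z - 1)).
  move=> /= le.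
  have hE := EU_subspace ((p + (d + n))%:Z - 1).
  have IHpn : (p + n < N)%N by lia.
  rewrite -[Y b l _](subrK (Y a (- k%:Z) (Y b l w))).
  apply: (subspaceD hE).
    apply: (commutator_in hY) => // s.
    have := gva_mode hV s%:Z Gb Ga.
    (* [q] is the weight of $b_s a$, at most [d + p - 1]; a negative weight means that this vector
       is zero. *)
    case qE: (d%:Z + p%:Z - s%:Z - 1) => [q|q] /=; last first.
      by move=> ->; rewrite mode0l; case: hE.
    move=> Gq; have qn : (q + n < N)%N by lia.
    have [h _] := IH _ qn q n (leqnn _) _ _ (l + - k%:Z - s%:Z) Gq Ew.
    by apply: EU_le h; lia.
  have [_ h] := IH _ IHpn p n (leqnn _) _ _ l Gb Ew.
  have -> : (p + (d + n))%:Z - 1 = d%:Z + ((p + n)%:Z - 1) by lia.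
  exact: EU_mul (h l0).
move=> p n pnN b w l Gb Ew; split; last exact: nonneg.
have hE := EU_subspace (p + n)%N.
apply: (lspan_min (subspace_preim (linl l w) hE)) (weight_spanned Gb) => {b Gb}.
move=> _ [[-> ->]|[d [k [q [u [b [[Uu Gu Gb k0 dkq] ->]]]]]]] /=.
  by rewrite (va_vacuum hY); case: ifP => // _; case: (EU_subspace n).
have [d0|d0] := posnP d.
  by rewrite d0 in Gu; rewrite (U_weight0 Uu Gu) !mode0l; case: hE.
have qn : (q + n < N)%N by lia.
apply: (iterate_in hY) => // s.
  have [h _] := IH _ qn q n (leqnn _) _ _ (l + s%:Z) Gb Ew.
  have -> : - k%:Z - s%:Z = - (k + s)%:Z by lia.
  have h' := EU_mul Uu Gu (ltn_addr s k0) h.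
  by apply: EU_le h'; lia.
(* For [k = 1] and [q = 0] one has [d = p], so [d + n] may equal [N], out of reach of [IH]; this is
   why [nonneg] was proved first. *)
have dn : (d + n <= N)%N by lia.
have := nonneg d n u w s%:Z dn Gu Ew isT.
have -> : (d + n)%:Z - 1 = (d.-1 + n)%N by lia.
move=> Euw; have qdn : (q + (d.-1 + n) < N)%N by lia.
have [h _] := IH _ qdn q _ (leqnn _) _ _ (l + - k%:Z - s%:Z) Gb Euw.
by apply: EU_le h; lia.
Qed.

Lemma G_sub_EU n : G n `<=` E n.
Proof.
move=> v Gv; have E1 : E 0 one by exact: EU_one.
have [h _] := G_mode_EU (leqnn _) (-1) Gv E1.
by rewrite (va_creation_m1 hY) addn0 in h.
Qed.

(** Induction on the monomial in the first argument: the iterate formula expands $(a_{-k} u)_j$, and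
    [G_mode_EU] controls the modes of the homogeneous [a]. *)
Lemma EU_mode (m n : nat) u v (j : int) : E m u -> E n v ->
  E (m + n)%N (Y u j v) /\ (0 <= j -> E ((m + n)%:Z - 1) (Y u j v)).
Proof.
move=> Eu; move: n v j.
pose P m := [set u | forall (n : nat) v j, E n v ->
  E (m + n)%N (Y u j v) /\ (0 <= j -> E ((m + n)%:Z - 1) (Y u j v))].
apply: (EU_ind (P := P)) Eu =>
  {m u} [m|m n v j Ev|d k m a u Ua Ga d0 k0 Eu IH n v j Ev].
- split=> [n v j Ev|c u u' Pu Pu' n v j Ev].
    rewrite mode0l; split=> [|_]; first by case: (EU_subspace (m + n)%N).
    by case: (EU_subspace ((m + n)%:Z - 1)).
  have [h1 h2] := Pu n v j Ev; have [h1' h2'] := Pu' n v j Ev.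
  rewrite linl; split=> [|j0].
    by case: (EU_subspace (m + n)%N) => _; apply.
  case: (EU_subspace ((m + n)%:Z - 1)) => _; apply; [exact: h2 | exact: h2'].
- rewrite (va_vacuum hY); split.
    case: ifP => _; last by case: (EU_subspace (m + n)%N).
    by apply: EU_le Ev; lia.
  move=> j0; have -> : (j == -1) = false by apply/eqP; lia.
  by case: (EU_subspace ((m + n)%:Z - 1)).
have av s : E (d.-1 + n)%N (Y a s%:Z v).
  have [_ /(_ isT)] := G_mode_EU (leqnn _) s%:Z Ga Ev.
  by have -> : (d + n)%:Z - 1 = (d.-1 + n)%N by lia.
(* Both bounds follow at once with [e] as the target index: the terms $u_i (a_s v)$ already gain 1
   from [av], so only the terms $a_{-k-s} (u_{j+s} v)$ distinguish the two cases. *)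
have key (e : int) : (d + m + n)%:Z - 1 <= e ->
    (forall s : nat, E (e - d%:Z) (Y u (j + s%:Z) v)) ->
    E e (Y (Y a (- k%:Z) u) j v).
  move=> le_e hu; apply: (iterate_in hY (EU_subspace e)) => s.
    have -> : - k%:Z - s%:Z = - (k + s)%:Z by lia.
    rewrite -[e](subrKC d%:Z).
    exact: EU_mul (ltn_addr s k0) (hu s).
  have [h _] := IH _ _ (j + - k%:Z - s%:Z) (av s).
  by apply: EU_le h; lia.
split=> [|j0]; apply: key => [|s]; try lia.
  have [h _] := IH _ _ (j + s%:Z) Ev.
  by apply: EU_le h; lia.
have [_ h] := IH _ _ (j + s%:Z) Ev.
by have := h (ltac:(lia)); apply: EU_le; lia.
Qed.

Lemma EU_good : good_filtration Y one E.
Proof.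
split=> [n|n||||].
- exact: EU_subspace.
- by apply: EU_le; lia.
- apply/seteqP; split=> // v _.
  have [_ VG _] := gva_coprod hV.
  have [N [f [fG ->]]] : sumset G v by rewrite -VG.
  exists N%:Z => //; apply: subspace_sum => [|i _]; first exact: EU_subspace.
  by apply: EU_le (G_sub_EU (fG i)); have := ltn_ord i; lia.
- exact: EU_one.
(* A negative index forces the vector to be zero, which leaves the case of natural indices. *)
- move=> [m|m] [n|n] j u v Eu Ev _; last 3 first.
  + by rewrite (EU_neg _ Ev) // mode0r; case: (EU_subspace (m%:Z + Negz n)).
  + by rewrite (EU_neg _ Eu) // mode0l; case: (EU_subspace (Negz m + n%:Z)).
  + by rewrite (EU_neg _ Ev) // mode0r; case: (EU_subspace (Negz m + Negz n)).
  by have [] := EU_mode j Eu Ev.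
- move=> [m|m] [n|n] j u v Eu Ev j0; last 3 first.
  + by rewrite (EU_neg _ Ev) // mode0r; case: (EU_subspace (m%:Z + Negz n - 1)).
  + by rewrite (EU_neg _ Eu) // mode0l; case: (EU_subspace (Negz m + n%:Z - 1)).
  + by rewrite (EU_neg _ Ev) // mode0r; case: (EU_subspace (Negz m + Negz n - 1)).
  by have [_] := EU_mode j Eu Ev; apply.
Qed.

Lemma EU_finest : finest_good_filtration Y one
  (fun F => forall n : nat, G n `<=` F n%:Z) E.
Proof.
split=> [||F hF FG]; [exact: EU_good | exact: G_sub_EU |].
have hFs := gf_subspace hF.
have Fle (m n : int) : m <= n -> F m `<=` F n.
  move=> mn; have -> : n = m + `|n - m|%N by lia.
  elim: `|_|%N => [|p IH]; first by rewrite addr0.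
  by rewrite -addn1 PoszD addrA => v /IH; exact: (gf_incr hF).
case=> n v; last by move=> ->; case: (hFs (Negz n)).
move: n v; apply: EU_ind => [n //|n|d k n u w Uu Gu d0 k0 _ Fw].
  exact: Fle (gf_one hF).
by rewrite PoszD; apply: (gf_neg hF) => //; [exact: FG | lia].
Qed.

End StrongGenerators.

Theorem theorem4p14 (R : realType) (V : lmodType R[i])
    (Y : V -> int -> V -> V) (one : V) (G : nat -> set V)
    (hV : graded_vertex_algebra Y one G)
    (hG0 : G 0%N = [set v | exists c : R[i], v = c *: one]) :
  (forall U U' : set V,
     graded_subspace G U -> U `<=` positive_part G ->
     strongly_generates Y one U ->
     graded_subspace G U' -> U' `<=` positive_part G ->
     strongly_generates Y one U' ->
     EU Y one G U = EU Y one G U')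
  /\
  (forall U : set V,
     graded_subspace G U -> U `<=` positive_part G ->
     strongly_generates Y one U ->
     good_filtration Y one (EU Y one G U)
     /\ unique
          (finest_good_filtration Y one
             (fun E => forall n : nat, G n `<=` E n%:Z))
          (EU Y one G U)).
Proof.
have G1 : G 0%N one by rewrite hG0; exists 1; rewrite scale1r.
have finest_eq P (F F' : int -> set V) : finest_good_filtration Y one P F ->
    finest_good_filtration Y one P F' -> F = F'.
  move=> [hF PF Fmin] [hF' PF' Fmin']; apply/funext => n.
  by apply/seteqP; split; [exact: Fmin | exact: Fmin'].
split=> [U U' gU pU sU gU' pU' sU'|U gU pU sU].
  exact: finest_eq (EU_finest hV G1 gU pU sU) (EU_finest hV G1 gU' pU' sU').
have fU := EU_finest hV G1 gU pU sU.
by split; [case: fU | split=> // F; exact: finest_eq].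
Qed.
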